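(* Let $X,Y$ be Banach spaces, $U\subset X$ open, $f\colon U\to Y$ twice continuously differentiable, and let $x_0\in U$ be such that $D:=df(x_0)\colon X\to Y$ is surjective and has a bounded linear right inverse $Q\colon Y\to X$. Let $\delta,c,c_2>0$ be constants such that $\|Q\|\le c$, $B_\delta(x_0;X)\subset U$, and $$\|df(x)-D\|\le\tfrac{1}{4c}\quad\text{and}\quad \|d^2f(x)\|\le c_2\qquad\text{for all }x\in B_\delta(x_0;X).$$ Put $\hat\delta:=\min\{\delta,\frac{1}{4cc_2}\}\in(0,1)$. Let $\mathcal{N}=\mathcal{N}^f_{x_0,Q}\colon U_0(\delta)\to X$ be the Newton-Picard map of $f$. Let $x_1\in U_0(\delta)$ and let $\xi_1\in X$ satisfy $$\|\xi_1\|<\frac{\delta}{8(1+\|d\mathcal{N}|_{x_0}\|)},\qquad \|df|_{x_1}\xi_1\|_Y<\frac{\delta}{4c}.$$ Then there is the identity $T\mathcal{N}^f_{x_0,Q}=\mathcal{N}^{Tf}_{(x_0,0),Q\oplus Q}$ at $(x_1,\xi_1)$. That is, the unique pair $(x,\xi)\in X\oplus X$ with $$f(x)=0,\quad df|_x\xi=0,\quad x-x_1\in\operatorname{im}Q,\quad \xi-\xi_1\in\operatorname{im}Q,\quad \max\bigl\{\|x-x_0\|,\tfrac{\hat\delta}{\delta}\|\xi\|\bigr\}<\delta$$ is given by $x=\mathcal{N}(x_1)$ and $\xi=d\mathcal{N}|_{x_1}\xi_1$.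
   Context: Let $U_0(\delta)=\{x_1\in B_{\delta/8}(x_0;X)\mid \|f(x_1)\|_Y<\frac{\delta}{4c}\}$. For each $x_1\in U_0(\delta)$ there is (known result of McDuff and Salamon) a unique $x\in X$ with $f(x)=0$, $x-x_1\in\operatorname{im}Q$ and $\|x-x_0\|<\delta$; the Newton-Picard map is $\mathcal{N}\colon U_0(\delta)\to X$, $x_1\mapsto x$. It is continuously differentiable, and $T\mathcal{N}(x_1,\xi_1)=(\mathcal{N}(x_1),d\mathcal{N}|_{x_1}\xi_1)$. The differential of $\mathcal N$ at the initial point $x_0$ is taken to be $d\mathcal{N}|_{x_0}=\mathrm{Id}-QD$. The tangent map of $f$ is $Tf\colon U\times X\to Y\oplus Y$, $Tf(x,\xi)=(f(x),df|_x\xi)$; its derivative at $(x_0,0)$ is $D\oplus D$, with right inverse $Q\oplus Q$. The space $TX=X\oplus X$ carries the norm $\|(x,\xi)\|=\max\{\|x\|,\frac{\hat\delta}{\delta}\|\xi\|\}$, and similarly $TY=Y\oplus Y$. The Newton-Picard map $\mathcal{N}^{Tf}_{(x_0,0),Q\oplus Q}$ sends $(x_1,\xi_1)$ to the unique zero $(x,\xi)$ of $Tf$ with $(x,\xi)-(x_1,\xi_1)\in\operatorname{im}(Q\oplus Q)$ and $\|(x,\xi)-(x_0,0)\|<\delta$. *)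

(* Defs.v *)
From HB Require Import structures.
From mathcomp Require Import all_boot all_order all_algebra.
From mathcomp Require Import all_classical all_reals all_analysis.

Set Implicit Arguments.
Unset Strict Implicit.
Unset Printing Implicit Defensive.

Import Order.TTheory GRing.Theory Num.Theory.
Import numFieldNormedType.Exports.

Local Open Scope classical_set_scope.
Local Open Scope ring_scope.

Section opnorm.
Context {R : realType} {V W : normedModType R}.

(* Meaningful only when [f] is a bounded linear map: [sup] is 0 on unbounded
   sets. *)
Definition opnorm (f : V -> W) : R :=
  sup [set `|f x| | x in [set x | `|x| <= 1]].

Definition blin_pred : {pred V -> W} :=
  fun f => `[< linear f /\ continuous f >].

Lemma blin_pred_submod_closed : submod_closed blin_pred.
Proof.
split.
  apply/asboolP; split; last by move=> x; exact: cst_continuous.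
  by move=> a x y; rewrite /= scaler0 addr0.
move=> a f g /asboolP[lf cf] /asboolP[lg cg]; apply/asboolP; split.
  move=> b x y; rewrite (_ : a *: f + g = fun z => a *: f z + g z)//.
  by rewrite lf lg !scalerDr !scalerA (mulrC b a) -!addrA; congr +%R;
    rewrite addrCA.
move=> x; rewrite /continuous_at.
have -> : a *: f + g = (fun y => a *: f y + g y) by [].
by apply: cvgD; [apply: cvgZr; exact: cf | exact: cg].
Qed.

HB.instance Definition _ :=
  GRing.isSubmodClosed.Build R (V -> W) blin_pred blin_pred_submod_closed.

End opnorm.

Section blin.
Context (R : realType) (V W : normedModType R).

Record blin := Blin {
  blin_fun :> V -> W ;
  _ : blin_fun \in (@blin_pred R V W) }.

HB.instance Definition _ := [isSub for blin_fun].
HB.instance Definition _ := [Choice of blin by <:].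
HB.instance Definition _ := [SubChoice_isSubLmodule of blin by <:].

Implicit Types A B : blin.

Lemma blin_linear A : linear A.
Proof. by have /asboolP[] := valP A. Qed.

Lemma blin_continuous A : continuous A.
Proof. by have /asboolP[] := valP A. Qed.

HB.instance Definition _ A :=
  GRing.isLinear.Build R V W _ (blin_fun A) (blin_linear A).

Lemma blin_has_sup A : has_sup [set `|A x| | x in [set x | `|x| <= 1]].
Proof.
split; first by exists `|A 0|, 0 => //=; rewrite normr0.
have := continuous_linear_bounded 0 (@blin_continuous A 0).
move=> /linear_boundedP /pinfty_ex_gt0[M M0 AM].
exists M => _ [x /= x1 <-]; rewrite (le_trans (AM x))//.
by rewrite ler_piMr// ltW.
Qed.

Lemma opnorm_ge0 A : 0 <= opnorm A.
Proof.
apply: le_trans (normr_ge0 (A 0)) _.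
by apply: ub_le_sup; [exact: (blin_has_sup A).2 | exists 0; rewrite //= normr0].
Qed.

Lemma opnorm_le A x : `|A x| <= opnorm A * `|x|.
Proof.
have [->|x0] := eqVneq x 0; first by rewrite linear0 !normr0 mulr0.
have nx0 : 0 < `|x| by rewrite normr_gt0.
rewrite -ler_pdivrMr//.
have -> : `|A x| / `|x| = `|A (`|x|^-1 *: x)|.
  by rewrite linearZ normrZ normfV normr_id mulrC.
apply: ub_le_sup; first exact: (blin_has_sup A).2.
by exists (`|x|^-1 *: x) => //=; rewrite normrZ normfV normr_id mulVf// gt_eqF.
Qed.

Lemma opnorm_lub A (M : R) : 0 <= M ->
  (forall x, `|A x| <= M * `|x|) -> opnorm A <= M.
Proof.
move=> M0 AM; apply: ge_sup; first exact: (blin_has_sup A).1.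
by move=> _ [x /= x1 <-]; rewrite (le_trans (AM x))// ler_piMr.
Qed.

Lemma opnormD A B : opnorm (A + B) <= opnorm A + opnorm B.
Proof.
apply: opnorm_lub => [|x]; first by rewrite addr_ge0 ?opnorm_ge0.
rewrite mulrDl (_ : (A + B) x = A x + B x)//.
by rewrite (le_trans (ler_normD _ _))// lerD ?opnorm_le.
Qed.

Let opnormZ_le (a : R) A : opnorm (a *: A) <= `|a| * opnorm A.
Proof.
apply: opnorm_lub => [|x]; first by rewrite mulr_ge0 ?opnorm_ge0.
rewrite (_ : (a *: A) x = a *: A x)// normrZ -mulrA.
by rewrite ler_wpM2l ?opnorm_le.
Qed.

Lemma opnormZ (a : R) A : opnorm (a *: A) = `|a| * opnorm A.
Proof.
apply/eqP; rewrite eq_le opnormZ_le andTb.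
have [->|a0] := eqVneq a 0; first by rewrite normr0 mul0r opnorm_ge0.
rewrite -ler_pdivlMl ?normr_gt0// -normfV.
by rewrite (le_trans _ (opnormZ_le _ _))// scalerA mulVf// scale1r.
Qed.

Lemma opnorm_eq0 A : opnorm A = 0 -> A = 0.
Proof.
move=> A0; apply/val_inj/funext => x; apply/eqP.
by rewrite -normr_le0 (le_trans (opnorm_le A x))// A0 mul0r.
Qed.

HB.instance Definition _ := Lmodule_isNormed.Build R blin
  opnormD opnormZ opnorm_eq0.

End blin.

Notation "{ 'blin' V -> W }" := (blin V W)
  (at level 0, V at level 98, W at level 99, format "{ 'blin'  V  ->  W }")
  : type_scope.

Section differential.
Context {R : realType} {V W : normedModType R}.

(* ['d f x] as an element of the normed space of bounded linear maps, so that
   the differential can itself be differentiated.  The default 0 is taken only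
   if ['d f x] is discontinuous, hence never where [f] is differentiable. *)
Definition dmap (f : V -> W) (x : V) : {blin V -> W} := insubd 0 ('d f x : V -> W).

End differential.

(* For [U] open; [f] is a total function, of which only the values on [U]
   matter. *)
Definition C2_on (R : realType) (V W : normedModType R) (U : set V)
    (f : V -> W) : Prop :=
  forall x, U x ->
    [/\ differentiable f x, differentiable (dmap f) x
      & {for x, continuous (dmap (dmap f))}].

Section newton_picard.
Context {R : realType} {V W : zmodType}.

(* The norm on [V] is an argument because the tangent space carries a weighted
   norm.  The domain of [F] is not mentioned: it is required to contain the
   [delta]-ball around [v0]. *)
Definition is_newton_picard (nrm : V -> R) (delta : R) (F : V -> W) (v0 : V)
    (P : W -> V) (v1 v : V) : Prop :=
  [/\ F v = 0, range P (v - v1) & nrm (v - v0) < delta].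

Definition newton_picard (nrm : V -> R) (delta : R) (F : V -> W) (v0 : V)
    (P : W -> V) (v1 : V) : V :=
  xget v1 [set v | is_newton_picard nrm delta F v0 P v1 v].

End newton_picard.

Definition newton_domain (R : realType) (V W : normedModType R) (delta c : R)
    (f : V -> W) (x0 : V) : set V :=
  [set x1 | ball x0 (delta / 8) x1 /\ `|f x1| < delta / (4 * c)].

Definition delta_hat (R : realType) (delta c c2 : R) : R :=
  Num.min delta (1 / (4 * c * c2)).

Definition weighted_norm (R : realType) (V : normedModType R) (rho : R)
    (p : V * V) : R := Num.max `|p.1| (rho * `|p.2|).

Definition tangent_map (R : realType) (V W : normedModType R) (F : V -> W)
    (p : V * V) : W * W := (F p.1, dmap F p.1 p.2).

Definition oplus (V W : Type) (A : V -> W) (p : V * V) : W * W :=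
  (A p.1, A p.2).

(* Main.v *)
Require Import Defs.
From HB Require Import structures.
From mathcomp Require Import all_boot all_order all_algebra.
From mathcomp Require Import all_classical all_reals all_analysis.
From mathcomp Require Import ring lra.

Set Implicit Arguments.
Unset Strict Implicit.
Unset Printing Implicit Defensive.

Import Order.TTheory GRing.Theory Num.Theory.
Import numFieldNormedType.Exports.

Local Open Scope classical_set_scope.
Local Open Scope ring_scope.

(** On the [delta]-ball around [x0] the map [f] differs from its linear part
[D = dmap f x0] by a [1 / (4 * c)]-Lipschitz error, plus a constant (mean value
inequality).  As [c] bounds the right
inverse [Q] of [D], the map [y |-> f (z + Q y)] is a [1 / 4]-contractive
perturbation of the identity of [Y].  Hence a zero of [f] on the affine slice
[z + range Q] is unique in the [delta]-ball ([slice_zero_unique]), and the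
Banach fixed point theorem provides one when [f z] is small
([slice_zero_exists]).  This is the Newton-Picard map [N].

The hypotheses of this slice argument hold for every map so close to [D], in
particular for the linear map [A = dmap f (N z)].  Applied to [A], the argument
gives, for each [h], a unique [L h] with [A (L h) = 0] and [L h - h] in
[range Q]; [L] is linear and bounded ([kernel_projection]).  This [L] is the
derivative of [N] at [z] ([zero_map_differentiable]): both [N w - N z] and
[L (w - z)] differ from [w - z] by an element of [range Q], while [A] kills the
second and maps the first to [o (w - z)], since [f] vanishes at [N w] and [N z];
as [A] expands on [range Q], the two agree up to [o (w - z)].

Consequently [dmap N x1 xi1] is the only zero of [dmap f (N x1)] on the slice
[xi1 + range Q], so the two components of the Newton-Picard zero of the tangent
map of [f] are [N x1] and [dmap N x1 xi1].  What remains is the bound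
[rho * `|dmap N x1 xi1| < delta]; it follows from [rho <= 1] and
[newton_picard_tangent_lt]. *)

(** * Bounded linear maps and differentials *)

Lemma blinB (R : realType) (V W : normedModType R) (A : {blin V -> W})
  (x y : V) : A (x - y) = A x - A y.
Proof. exact: linearB. Qed.

Lemma blinP (R : realType) (V W : normedModType R) (A : {blin V -> W}) (a : R)
  (x y : V) : A (a *: x + y) = a *: A x + A y.
Proof. exact: linearP. Qed.

Lemma norm_blin_le (R : realType) (V W : normedModType R)
  (A : {blin V -> W}) (K : R) (x : V) : `|A| <= K -> `|A x| <= K * `|x|.
Proof.
by move=> AK; rewrite (le_trans (opnorm_le A x))// ler_wpM2r.
Qed.

Lemma dmapE (R : realType) (V W : normedModType R) (f : V -> W) (x : V) :
  differentiable f x -> dmap f x = 'd f x :> (V -> W).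
Proof.
move=> df; rewrite /dmap; apply: (@insubdK _ _ {blin V -> W}).
apply/asboolP; split; last exact: diff_continuous.
exact: linearP.
Qed.

Lemma differentiable_norm_le (R : realType) (V W : normedModType R)
    (f : V -> W) (x : V) (e : R) : differentiable f x -> 0 < e ->
  \forall v \near x, `|f v - f x - dmap f x (v - x)| <= e * `|v - x|.
Proof.
move=> df e0; have /diff_locally/eqaddoP/(_ e e0) := df.
rewrite near_simpl (near_shift x 0) sub0r; apply: filterS => v.
by rewrite -[X in `|X| <= _ -> _]/(f (v - x + x) - (f x + 'd f x (v - x)))
           subrK opprD addrA (dmapE df).
Qed.

Lemma differentiable_of_norm_le (R : realType) (V W : normedModType R)
    (f : V -> W) (x : V) (A : {blin V -> W}) :
  (forall e : R, 0 < e ->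
     \forall v \near x, `|f v - f x - A (v - x)| <= e * `|v - x|) ->
  differentiable f x /\ dmap f x = A.
Proof.
move=> fA.
have fE : f \o shift x = cst (f x) + A +o_ 0 id.
  apply/eqaddoP => e e0; rewrite near_simpl (near_shift x 0) sub0r.
  apply: filterS (fA e e0) => v.
  by rewrite -[X in _ -> `|X| <= _]/(f (v - x + x) - (f x + A (v - x)))
             subrK opprD addrA.
have cA : continuous A by exact: blin_continuous.
have dfA : 'd f x = A :> (V -> W) by exact: diff_unique.
have df : differentiable f x by apply/diff_locallyP; rewrite dfA.
by split=> //; apply/val_inj; rewrite /= dmapE.
Qed.

(** * The mean value inequality *)

(** The set of [t] with [`|g t - g 0| <= M * t] contains its supremum, and the
local estimate at the supremum lets one step beyond it unless it is 1. *)
Lemma local_lipschitz_unit_interval (R : realType) (W : normedModType R)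
    (g : R -> W) (M : R) : 0 <= M ->
  (forall t : R, 0 <= t <= 1 ->
     \forall s \near t, `|g s - g t| <= M * `|s - t|) ->
  `|g 1 - g 0| <= M.
Proof.
move=> M0 gM.
pose S := [set t : R | 0 <= t <= 1 /\ `|g t - g 0| <= M * t].
have S0 : S 0 by split; rewrite ?lexx ?ler01// subrr normr0 mulr0.
have supS : has_sup S.
  by split; [exists 0 | exists 1 => t [/andP[]]].
have sup0 : 0 <= sup S by exact: ub_le_sup supS.2 _ S0.
have sup1 : sup S <= 1 by apply: ge_sup supS.1 _ => t [/andP[]].
have /nbhs_normP[e /= e0 eg] : \forall s \near sup S,
    `|g s - g (sup S)| <= M * `|s - sup S|.
  by apply: gM; rewrite sup0.
have Ssup : S (sup S).
  split; first by rewrite sup0.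
  have [s Ss es] := sup_adherent e0 supS.
  have sS : s <= sup S by exact: ub_le_sup supS.2 _ Ss.
  have := eg s; rewrite /= ger0_norm ?subr_ge0// ltrBlDr addrC -ltrBlDr.
  move=> /(_ es); rewrite ler0_norm ?subr_le0// => gs.
  have -> : g (sup S) - g 0 = - (g s - g (sup S)) + (g s - g 0).
    by rewrite opprB addrA subrK.
  rewrite (le_trans (ler_normD _ _))// normrN.
  by rewrite (le_trans (lerD gs Ss.2))// -mulrDr opprB subrK.
have [S1|S1] := leP 1 (sup S).
  have e1 : sup S = 1 by apply/le_anti; rewrite sup1.
  by move: Ssup => [_]; rewrite e1 mulr1.
pose t := Num.min 1 (sup S + e / 2).
have tS : sup S < t by rewrite lt_min S1 ltrDl divr_gt0.
have te : t <= sup S + e / 2 by rewrite ge_min lexx orbT.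
have : S t.
  split; first by rewrite (le_trans sup0 (ltW tS)) ge_min lexx.
  have tn : `|t - sup S| = t - sup S by rewrite gtr0_norm// subr_gt0.
  have := eg t; rewrite /= distrC tn => /(_ ltac:(lra)) gt.
  have -> : g t - g 0 = (g t - g (sup S)) + (g (sup S) - g 0).
    by rewrite addrA subrK.
  rewrite (le_trans (ler_normD _ _))//.
  by rewrite (le_trans (lerD gt Ssup.2))// -mulrDr subrK.
by move=> /(ub_le_sup supS.2); rewrite leNgt tS.
Qed.

(** The map [f - D] is differentiable along the segment with differential
bounded by [K], so around each point of the segment its increments from that point are
bounded with any constant above [K]. *)
Lemma mean_value_inequality (R : realType) (V W : normedModType R)
    (f : V -> W) (D : {blin V -> W}) (K : R) (a b : V) :
  (forall t : R, 0 <= t <= 1 -> differentiable f (b + t *: (a - b)) /\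
     `|dmap f (b + t *: (a - b)) - D| <= K) ->
  `|f a - f b - D (a - b)| <= K * `|a - b|.
Proof.
move=> fD.
have K0 : 0 <= K by have [|_] := fD 0; [rewrite lexx ler01|apply: le_trans].
pose p t := b + t *: (a - b).
have pB s t : p s - p t = (s - t) *: (a - b).
  by rewrite /p opprD addrACA subrr add0r -scalerBl.
have [->|ab] := eqVneq a b; first by rewrite !subrr linear0 subr0 !normr0 mulr0.
have ab0 : 0 < `|a - b| by rewrite normr_gt0 subr_eq0.
apply/ler_addgt0Pr => _/posnumP[e].
have p1 : p 1 = a by rewrite /p scale1r addrC subrK.
have p0 : p 0 = b by rewrite /p scale0r addr0.
have -> : f a - f b - D (a - b) = (f (p 1) - D (p 1)) - (f (p 0) - D (p 0)).
  by rewrite p1 p0 linearB opprD addrACA -opprD.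
apply: (@local_lipschitz_unit_interval _ _ (fun t => f (p t) - D (p t))).
  by rewrite addr_ge0// mulr_ge0.
move=> t t01; have [df dK] := fD t t01.
have pc : p s @[s --> t] --> p t.
  by apply: cvgD; [exact: cvg_cst | apply: cvgZr_tmp; exact: cvg_id].
have e'0 : 0 < e%:num / `|a - b| by rewrite divr_gt0.
have fs : \forall s \near t, `|f (p s) - f (p t) - dmap f (p t) (p s - p t)| <=
    e%:num / `|a - b| * `|p s - p t|.
  exact: pc _ (differentiable_norm_le df e'0).
apply: filterS fs => s fs.
have -> : f (p s) - D (p s) - (f (p t) - D (p t)) =
    (f (p s) - f (p t) - dmap f (p t) (p s - p t)) +
    (dmap f (p t) - D) (p s - p t).
  rewrite [(_ - D) _](_ : _ = dmap f (p t) (p s - p t) - D (p s - p t))//.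
  by rewrite addrA subrK (linearB D) [in LHS]opprD addrACA -[in LHS]opprD.
rewrite (le_trans (ler_normD _ _))//.
rewrite (le_trans (lerD fs (norm_blin_le _ dK)))//.
rewrite -mulrDl pB normrZ mulrCA [leRHS]mulrC ler_wpM2l//.
by rewrite mulrDl divfK ?gt_eqF// addrC.
Qed.

Lemma norm_ball_convex (R : realType) (V : normedModType R) (x a b : V)
    (r t : R) : `|a - x| < r -> `|b - x| < r -> 0 <= t <= 1 ->
  `|b + t *: (a - b) - x| < r.
Proof.
move=> ar br /andP[t0 t1].
have -> : b + t *: (a - b) - x = t *: (a - x) + (1 - t) *: (b - x).
  have ab : a - x - (b - x) = a - b by rewrite opprB addrA subrK.
  by rewrite scalerBl scale1r addrCA -scalerBr ab addrAC.
rewrite (le_lt_trans (ler_normD _ _))// !normrZ (ger0_norm t0).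
rewrite (ger0_norm (_ : 0 <= 1 - t)) ?subr_ge0//.
have [->|t0'] := eqVneq t 0; first by rewrite mul0r add0r subr0 mul1r.
have tp : 0 < t by rewrite lt_neqAle eq_sym t0'.
have := ltr_leD (_ : t * `|a - x| < t * r)
  (_ : (1 - t) * `|b - x| <= (1 - t) * r).
rewrite (_ : t * r + (1 - t) * r = r); last by ring.
apply; first by rewrite ltr_pM2l.
by rewrite ler_wpM2l ?subr_ge0// ltW.
Qed.

(** * Zeros along the range of a right inverse *)

Section right_inverse.
Context {R : realType} {X Y : normedModType R}.
Context {D : {blin X -> Y}} {Q : {blin Y -> X}} {c : R}.
Hypotheses (DQ : forall y, D (Q y) = y) (c0 : 0 < c) (Qc : `|Q| <= c).

Lemma norm_range_le (u : X) : range Q u -> `|u| <= c * `|D u|.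
Proof. by move=> [y _ <-]; rewrite DQ norm_blin_le. Qed.

Lemma range_blinB (u v : X) : range Q u -> range Q v -> range Q (u - v).
Proof. by move=> [y _ <-] [z _ <-]; exists (y - z); rewrite ?blinB. Qed.

(** On [range Q] the map [D] expands by at least [c^-1], and the Lipschitz error
[1 / (4 * c)] destroys at most a quarter of that. *)
Lemma slice_expansive (F : X -> Y) (a b : X) :
  range Q (a - b) -> `|F a - F b - D (a - b)| <= 1 / (4 * c) * `|a - b| ->
  `|a - b| <= 4 / 3 * c * `|F a - F b|.
Proof.
move=> abQ; rewrite distrC => Fab; have ab := norm_range_le abQ.
have DF : `|D (a - b)| <= `|F a - F b| + 1 / (4 * c) * `|a - b|.
  by rewrite -[X in `|X| <= _](subrK (F a - F b)) addrC
    (le_trans (ler_normD _ _))// lerD2l.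
have := le_trans ab (ler_wpM2l (ltW c0) DF).
rewrite mulrDr mulrA (_ : c * (1 / (4 * c)) = 1 / 4);
    last by field; rewrite gt_eqF.
by lra.
Qed.

Lemma slice_zero_unique (F : X -> Y) (v a b : X) :
  F a = 0 -> F b = 0 -> range Q (a - v) -> range Q (b - v) ->
  `|F a - F b - D (a - b)| <= 1 / (4 * c) * `|a - b| -> a = b.
Proof.
move=> Fa Fb av bv Fab.
have abQ : range Q (a - b).
  by have := range_blinB av bv; rewrite opprB addrA subrK.
have := slice_expansive abQ Fab.
by rewrite Fa Fb subrr normr0 mulr0 normr_le0 subr_eq0 => /eqP.
Qed.

(** A map [N] that moves each point along [range Q] into the zero set of [F] is
Lipschitz at [x], because [D] maps an increment [u] of [N] to a vector of norm
at most [1 / (4 * c) * `|u|].  Linearizing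
[F] at [N x] then gives [dmap F (N x) (N z - N x) = o (z - x)], and
[slice_expansive] for the linear map [dmap F (N x)] compares [N z - N x] with
[L (z - x)]. *)
Lemma zero_map_differentiable (F : X -> Y) (N : X -> X) (x : X)
    (L : {blin X -> X}) :
  differentiable F (N x) -> `|dmap F (N x) - D| <= 1 / (4 * c) ->
  (\forall z \near x, [/\ F (N z) = 0, range Q (N z - z) &
     `|F (N z) - F (N x) - D (N z - N x)| <= 1 / (4 * c) * `|N z - N x|]) ->
  (forall h, dmap F (N x) (L h) = 0 /\ range Q (L h - h)) ->
  differentiable N x /\ dmap N x = L.
Proof.
move=> dF AD nearN LP; apply: differentiable_of_norm_le => e e0.
set A := dmap F (N x) in AD LP *.
have [Fx Nx _] := nbhs_singleton nearN.
pose C := 4 / 3 * (1 + c * `|D|).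
have C0 : 0 < C by rewrite mulr_gt0 ?divr_gt0// ltr_pwDl// mulr_ge0// ltW.
have lipN : \forall z \near x, `|N z - N x| <= C * `|z - x|.
  apply: filterS nearN => z [Fz Nz].
  rewrite Fz Fx subrr sub0r normrN => Du.
  have uQ : range Q ((N z - N x) - (z - x)).
    rewrite (_ : _ - _ = (N z - z) - (N x - x)); first exact: range_blinB.
    by rewrite opprD addrACA -opprD.
  have := norm_range_le uQ; rewrite blinB => uh.
  have u1 : `|N z - N x| <= `|N z - N x - (z - x)| + `|z - x|.
    by rewrite -[X in `|X| <= _](subrK (z - x)) ler_normD.
  have := ler_normB (D (N z - N x)) (D (z - x)).
  have := norm_blin_le (z - x) (lexx `|D|).
  move=> Dh Duh.
  have := le_trans uh (ler_wpM2l (ltW c0) (le_trans Duh (lerD Du Dh))).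
  rewrite mulrDr mulrA (_ : c * (1 / (4 * c)) = 1 / 4);
    last by field; rewrite gt_eqF.
  rewrite /C; lra.
have c43 : 0 < 4 / 3 * c by rewrite mulr_gt0// divr_gt0.
(* passing from [N z - N x] to [z - x] costs the factor [C], inverting [A] along
   [range Q] the factor [4 / 3 * c] *)
have e'0 : 0 < e / (4 / 3 * c * C) by exact: divr_gt0 e0 (mulr_gt0 c43 C0).
have /nbhs_normP[r /= r0 rF] := differentiable_norm_le dF e'0.
have rC0 : 0 < r / C by rewrite divr_gt0.
have nearx : \forall z \near x, `|x - z| < r / C.
  by apply/nbhs_normP; exists (r / C).
apply: filterS3 nearN lipN nearx => z [Fz Nz _] Nzx zx.
have uQ : range Q (N z - N x - L (z - x)).
  rewrite (_ : _ - _ = (N z - z) - (N x - x) - (L (z - x) - (z - x))).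
    by apply: range_blinB (LP _).2; exact: range_blinB.
  rewrite (_ : N z - z - (N x - x) = N z - N x - (z - x)).
    by move: (z - x) => h; rewrite (opprB _ h) addrA subrK.
  by rewrite opprD addrACA -opprD.
have Nzr : ball_ Num.norm (N x) r (N z).
  rewrite /= distrC (le_lt_trans Nzx)// distrC mulrC.
  by rewrite -ltr_pdivlMr.
have := rF _ Nzr; rewrite /= Fz Fx subrr sub0r normrN -/A => Au.
have := @slice_expansive A (N z - N x) (L (z - x)) uQ.
rewrite (LP _).1 subr0.
have := norm_blin_le (N z - N x - L (z - x)) AD.
rewrite (_ : (A - D) _ = A (N z - N x) - D (N z - N x - L (z - x))); last first.
  rewrite -[LHS]/(A (N z - N x - L (z - x)) - D (N z - N x - L (z - x))).
  by rewrite (blinB A _ (L _)) (LP _).1 subr0.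
move=> /[swap]/[apply] => uL.
have Auh := le_trans Au (ler_wpM2l (ltW e'0) Nzx).
rewrite (le_trans uL)// (le_trans (ler_wpM2l (ltW c43) Auh))//.
rewrite (_ : _ * (_ * (C * _)) = e * `|z - x|)//.
by field; rewrite !gt_eqF.
Qed.

End right_inverse.

Section newton_step.
Context {R : realType} {X : normedModType R} {Y : completeNormedModType R}.
Context {D : {blin X -> Y}} {Q : {blin Y -> X}} {c : R}.
Hypotheses (DQ : forall y, D (Q y) = y) (c0 : 0 < c) (Qc : `|Q| <= c).

(** The zeros on the slice are the points [v + Q y] with [y] a fixed point of
[T y = y - F (v + Q y)].  As [D (Q y) = y], [T] is a [1 / 4]-contraction, and
[`|T 0| = `|F v|] is small enough for it to preserve the closed ball of radius
[r / c] in [Y]. *)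
Lemma slice_zero_exists (F : X -> Y) (v : X) (r : R) : 0 <= r ->
  (forall a b, `|a - v| <= r -> `|b - v| <= r ->
     `|F a - F b - D (a - b)| <= 1 / (4 * c) * `|a - b|) ->
  c * `|F v| <= 3 / 4 * r ->
  exists x, [/\ F x = 0, range Q (x - v) & `|x - v| <= r].
Proof.
move=> r0 FD Fv.
pose B : set Y := closed_ball_ Num.norm 0 (r / c).
have BE y : B y = (`|y| <= r / c) by rewrite /B /closed_ball_/= sub0r normrN.
have BQ y : B y -> `|v + Q y - v| <= r.
  rewrite BE => yr; rewrite addrAC subrr add0r (le_trans (norm_blin_le _ Qc))//.
  by rewrite mulrC -ler_pdivlMr.
pose T y := y - F (v + Q y).
have TB y z : B y -> B z -> `|T y - T z| <= 1 / 4 * `|y - z|.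
  move=> By Bz; have := FD _ _ (BQ _ By) (BQ _ Bz).
  have -> : v + Q y - (v + Q z) = Q (y - z).
    by rewrite opprD addrACA subrr add0r blinB.
  rewrite DQ distrC => FT.
  have -> : T y - T z = y - z - (F (v + Q y) - F (v + Q z)).
    by rewrite /T opprD addrACA -opprD.
  rewrite (le_trans FT)// (le_trans (ler_wpM2l _ (norm_blin_le _ Qc)))//.
    by rewrite divr_ge0// mulr_ge0// ltW.
  by rewrite mulrA (_ : 1 / (4 * c) * c = 1 / 4)//; field; rewrite ?gt_eqF.
have B0 : B 0 by rewrite BE normr0 divr_ge0// ltW.
have TF : {homo T : y / B y >-> B y}.
  move=> y By; rewrite BE; have := TB _ _ By B0.
  rewrite subr0 => Ty; move: By; rewrite BE => yr.
  have T0 : `|T 0| <= 3 / 4 * (r / c).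
    rewrite /T linear0 addr0 sub0r normrN mulrA ler_pdivlMr// mulrC//.
  have := ler_normD (T y - T 0) (T 0); rewrite subrK; lra.
have [y By Ty] : exists2 y, B y & y = T y.
  apply: (@banach_fixed_point _ _ _ (mkfun_fun TF)).
  - exists (1 / 4)%:nng; split; first by rewrite /=; lra.
    by move=> [y z] [/= By Bz]; exact: TB.
  - exact: closed_closed_ball_.
  - by exists 0.
exists (v + Q y); split; last exact: BQ.
  by rewrite -[LHS](subKr y) -/(T y) -Ty subrr.
by exists y => //; rewrite addrAC subrr add0r.
Qed.

(** The projection onto the kernel of [A] along [range Q].  It is linear because
the zero of [A] on each slice is unique. *)
Lemma kernel_projection (A : {blin X -> Y}) : `|A - D| <= 1 / (4 * c) ->
  exists L : {blin X -> X}, forall h,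
    [/\ A (L h) = 0, range Q (L h - h) & `|L h - h| <= 4 / 3 * c * `|A h|].
Proof.
move=> AD.
have AB a b : `|A a - A b - D (a - b)| <= 1 / (4 * c) * `|a - b|.
  by rewrite -blinB (norm_blin_le (a - b) AD).
have AL h : exists l,
    [/\ A l = 0, range Q (l - h) & `|l - h| <= 4 / 3 * c * `|A h|].
  apply: slice_zero_exists => //; first by rewrite !mulr_ge0// ltW.
  by rewrite !mulrA; lra.
have [L LP] := choice AL.
have linL : linear L.
  move=> a g h.
  apply: (slice_zero_unique DQ c0 Qc (F := A) (v := a *: g + h)) => //.
  - by have [] := LP (a *: g + h).
  - by rewrite blinP; have [-> _ _] := LP g; have [-> _ _] := LP h;
      rewrite scaler0 addr0.
  - by have [] := LP (a *: g + h).
  - have [_ [y _ yE] _] := LP g; have [_ [z _ zE] _] := LP h.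
    exists (a *: y + z) => //.
    by rewrite blinP yE zE scalerBr opprD addrACA.
pose lL : {linear X -> X} := HB.pack L (GRing.isLinear.Build R X X _ L linL).
have contL : continuous L.
  apply/(linear_bounded_continuous lL)/linear_boundedP.
  near=> M => h /=.
  have [_ _ Lh] := LP h.
  have := ler_normD (L h - h) h; rewrite subrK => /le_trans; apply.
  rewrite (le_trans (lerD Lh (lexx _)))//.
  rewrite (le_trans (lerD (ler_wpM2l _ (opnorm_le A h)) (lexx _)))//.
    by rewrite !mulr_ge0// ltW.
  rewrite mulrA -[X in _ + X]mul1r -mulrDl ler_wpM2r//.
have bL : L \in (@blin_pred R X X) by apply/asboolP.
by exists (Blin bL).
Unshelve. all: by end_near. Qed.

End newton_step.

(** * The Newton-Picard map *)

Section newton_picard_map.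
Context {R : realType} {X : normedModType R} {Y : completeNormedModType R}.
Context {f : X -> Y} {x0 : X} {Q : {blin Y -> X}} {delta c : R}.
Hypotheses (delta0 : 0 < delta) (c0 : 0 < c) (Qc : `|Q| <= c).
Hypothesis DQ : forall y, dmap f x0 (Q y) = y.
Hypothesis df : forall x, ball x0 delta x -> differentiable f x.
Hypothesis dfc :
  forall x, ball x0 delta x -> `|dmap f x - dmap f x0| <= 1 / (4 * c).

Local Notation N := (newton_picard Num.norm delta f x0 Q).

Lemma ball_approx (a b : X) : `|a - x0| < delta -> `|b - x0| < delta ->
  `|f a - f b - dmap f x0 (a - b)| <= 1 / (4 * c) * `|a - b|.
Proof.
move=> ad bd; apply: mean_value_inequality => t t01.
have tb : ball x0 delta (b + t *: (a - b)).
  by rewrite -ball_normE /ball_/= distrC norm_ball_convex.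
by split; [exact: df | exact: dfc].
Qed.

Lemma newton_picardP (z : X) : newton_domain delta c f x0 z ->
  is_newton_picard Num.norm delta f x0 Q z (N z).
Proof.
move=> [zx fz].
apply: (@xgetPex _ z (is_newton_picard Num.norm delta f x0 Q z)).
move: zx; rewrite -ball_normE /ball_/= distrC => zx.
have inb a : `|a - z| <= delta / 3 -> `|a - x0| < delta.
  by move=> az; have := ler_distD z a x0; move: delta0; lra.

(* [delta / 8 + delta / 3 < delta], so the slice ball lies in the domain *)
have [|||x [fx xQ xz]] :=
  @slice_zero_exists _ _ _ _ _ _ DQ c0 Qc f z (delta / 3).
- by rewrite divr_ge0// ltW.
- by move=> a b /inb ad /inb bd; exact: ball_approx.
- have := ltW fz; rewrite ler_pdivlMr ?mulr_gt0// => fz4; lra.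
by exists x; split=> //; exact: inb.
Qed.

Lemma newton_picard_unique (z a b : X) :
  is_newton_picard Num.norm delta f x0 Q z a ->
  is_newton_picard Num.norm delta f x0 Q z b -> a = b.
Proof.
move=> [fa aQ ad] [fb bQ bd].
exact: (slice_zero_unique DQ c0 Qc fa fb aQ bQ (ball_approx ad bd)).
Qed.

Lemma near_newton_domain (z : X) : newton_domain delta c f x0 z ->
  \forall w \near z, newton_domain delta c f x0 w.
Proof.
move=> [zx fz]; have zd : ball x0 delta z.
  by apply: le_ball zx; move: delta0; lra.
have cf : {for z, continuous f} := differentiable_continuous (df zd).
have cnf : `|f w| @[w --> z] --> `|f z| by exact: cvg_norm.
near=> w; split; near: w.
  by apply: open_nbhs_nbhs; split=> //; exact: ball_open.
by apply: (cvgr_lt _ cnf).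
Unshelve. all: by end_near. Qed.

Lemma newton_picard_differentiable (z : X) : newton_domain delta c f x0 z ->
  differentiable N z /\ forall h,
    [/\ dmap f (N z) (dmap N z h) = 0, range Q (dmap N z h - h)
      & `|dmap N z h - h| <= 4 / 3 * c * `|dmap f (N z) h|].
Proof.
move=> zU; have [fN NQ Nd] := newton_picardP zU.
have Nb : ball x0 delta (N z) by rewrite -ball_normE /ball_/= distrC.
have [L LP] := kernel_projection DQ c0 Qc (dfc Nb).
have [||dN NL] := zero_map_differentiable DQ c0 Qc (N := N) (L := L)
  (df Nb) (dfc Nb).
- apply: filterS (near_newton_domain zU) => w wU.
  by have [fw wQ wd] := newton_picardP wU; split=> //; exact: ball_approx.
- by move=> h; have [] := LP h.
by split=> // h; rewrite NL.
Qed.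

(** By [slice_expansive], [dmap N z h - h] is controlled by [dmap f (N z) h],
which differs from [dmap f z h] by at most [1 / (2 * c) * `|h|]; altogether the
norm stays below [13 / 24 * delta]. *)
Lemma newton_picard_tangent_lt (z h : X) : newton_domain delta c f x0 z ->
  `|h| < delta / 8 -> `|dmap f z h| < delta / (4 * c) ->
  `|dmap N z h| < delta.
Proof.
move=> zU hd zh; have [_ /(_ h)[_ _ Lh]] := newton_picard_differentiable zU.
have [_ _ Nd] := newton_picardP zU.
have [zb _] := zU.
have zd : ball x0 delta z.
  by apply: le_ball zb; move: delta0; lra.
have Nb : ball x0 delta (N z) by rewrite -ball_normE /ball_/= distrC.
have E : dmap f (N z) h = dmap f z h + (dmap f (N z) - dmap f x0) h
                            - (dmap f z - dmap f x0) h.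
  rewrite -[(dmap f (N z) - _) h]/(dmap f (N z) h - dmap f x0 h).
  rewrite -[(dmap f z - _) h]/(dmap f z h - dmap f x0 h).
  by rewrite opprB -addrA (addrA _ (dmap f x0 h)) subrK addrC subrK.
have := ler_normB (dmap f z h + (dmap f (N z) - dmap f x0) h)
  ((dmap f z - dmap f x0) h).
have := ler_normD (dmap f z h) ((dmap f (N z) - dmap f x0) h).
rewrite -E => E1 E2.
have := norm_blin_le h (dfc Nb); have := norm_blin_le h (dfc zd) => F1 F2.
have cF : c * `|dmap f (N z) h| <= c * `|dmap f z h| + 1 / 2 * `|h|.
  have : `|dmap f (N z) h| <= `|dmap f z h| + 1 / (2 * c) * `|h|.
    have -> : 1 / (2 * c) * `|h| = 1 / (4 * c) * `|h| + 1 / (4 * c) * `|h|.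
      by field; rewrite gt_eqF.
    by lra.
  move=> /(ler_wpM2l (ltW c0)) /le_trans; apply.
  by rewrite mulrDr mulrA (_ : c * (1 / (2 * c)) = 1 / 2)//; field;
    rewrite gt_eqF.
have cz : c * `|dmap f z h| < delta / 4.
  by move: zh; rewrite ltr_pdivlMr ?mulr_gt0//; lra.
have := ler_normD (dmap N z h - h) h; rewrite subrK.
by move: Lh delta0; rewrite -mulrA; lra.
Qed.

End newton_picard_map.

Theorem propositionB13 (R : realType) (X Y : completeNormedModType R)
    (U : set X) (f : X -> Y) (x0 : X) (Q : {blin Y -> X}) (delta c c2 : R)
    (x1 xi1 : X) :
  open U -> C2_on U f -> U x0 ->
  range (dmap f x0) = setT ->
  (forall y, dmap f x0 (Q y) = y) ->
  0 < delta -> 0 < c -> 0 < c2 ->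
  `|Q| <= c ->
  ball x0 delta `<=` U ->
  (forall x, ball x0 delta x -> `|dmap f x - dmap f x0| <= 1 / (4 * c)) ->
  (forall x, ball x0 delta x -> `|dmap (dmap f) x| <= c2) ->
  0 < delta_hat delta c c2 < 1 ->
  newton_domain delta c f x0 x1 ->
  `|xi1| < delta / (8 * (1 + opnorm (fun xi => xi - Q (dmap f x0 xi)))) ->
  `|dmap f x1 xi1| < delta / (4 * c) ->
  let rho := delta_hat delta c c2 / delta in
  let N := newton_picard Num.norm delta f x0 Q in
  [/\ differentiable N x1,
      tangent_map N (x1, xi1) =
        newton_picard (weighted_norm rho) delta (tangent_map f) (x0, 0)
          (oplus Q) (x1, xi1)
    & forall x xi : X,
        [/\ f x = 0, dmap f x xi = 0, range Q (x - x1), range Q (xi - xi1)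
          & Num.max `|x - x0| (rho * `|xi|) < delta]
        <-> x = N x1 /\ xi = dmap N x1 xi1].
Proof.
move=> _ C2f _ _ DQ delta0 c0 _ Qc ballU dfc _ /andP[hat0 _] x1U xi1_lt fxi1.
move=> rho N.
have df x : ball x0 delta x -> differentiable f x by move=> /ballU/C2f[].
have rho_le1 : rho <= 1 by rewrite ler_pdivrMr// mul1r ge_min lexx.
have xi1_lt8 : `|xi1| < delta / 8.
  apply: lt_le_trans xi1_lt _; set p := opnorm _.
  have p0 : 0 <= p.
    have [supP|/sup_out p0] := pselect (has_sup
        [set `|x - Q (dmap f x0 x)| | x in [set x : X | `|x| <= 1]]);
      last first.
      by rewrite /p /opnorm p0.
    apply: le_trans (ub_le_sup supP.2 _); last by exists 0; rewrite //= normr0.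
    exact: normr_ge0.
  by rewrite ler_pM2l// lef_pV2 ?posrE ?ler_peMr ?mulr_gt0 ?lerDl//; lra.
have [fN NQ Nd] := newton_picardP delta0 c0 Qc DQ df dfc x1U.
have [dN /(_ xi1)[fT TQ _]] :=
  newton_picard_differentiable delta0 c0 Qc DQ df dfc x1U.
have T_lt := newton_picard_tangent_lt delta0 c0 Qc DQ df dfc x1U xi1_lt8 fxi1.
rewrite -/N in fN NQ Nd dN fT TQ T_lt.
have pairP x xi :
    [/\ f x = 0, dmap f x xi = 0, range Q (x - x1), range Q (xi - xi1)
      & Num.max `|x - x0| (rho * `|xi|) < delta]
    <-> x = N x1 /\ xi = dmap N x1 xi1.
  split=> [[fx dfx xQ xiQ]|[-> ->]].
    rewrite gt_max => /andP[xd _].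
    have xN : x = N x1.
      by apply: (newton_picard_unique c0 Qc DQ df dfc (z := x1)); split.
    split=> //; move: dfx; rewrite xN => dfx.
    have Nb : ball x0 delta (N x1) by rewrite -ball_normE /ball_/= distrC.
    apply: (slice_zero_unique DQ c0 Qc dfx fT xiQ TQ).
    by rewrite -blinB; exact: norm_blin_le (dfc _ Nb).
  split=> //; rewrite gt_max Nd/= (le_lt_trans _ T_lt)//.
  by rewrite ler_piMl.
have rangeP (a b : X) : range (oplus Q) (a, b) <-> range Q a /\ range Q b.
  split=> [[[y z] _ [<- <-]]|[[y _ <-] [z _ <-]]]; last by exists (y, z).
  by split; [exists y | exists z].
have npP x xi : is_newton_picard (weighted_norm rho) delta (tangent_map f)
    (x0, 0) (oplus Q) (x1, xi1) (x, xi) <-> x = N x1 /\ xi = dmap N x1 xi1.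
  rewrite -pairP /is_newton_picard /tangent_map /weighted_norm/= subr0.
  split=> [[[fx dfx] /rangeP[xQ xiQ] lt]|[fx dfx xQ xiQ lt]]; split=> //.
    by rewrite fx dfx.
  exact/rangeP.
split=> //; apply/esym/xget_subset1; first exact/npP.
by move=> [x xi] [y yi] /npP[-> ->] /npP[-> ->].
Qed.
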